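(* Let $f(x),g(x)\in\mathbb{Z}[x]$ be non-zero polynomials. Then, for every choice of the auxiliary prime $q$ and of the pairwise distinct main primes $p$ made during its execution, the procedure BPN-e described in the context terminates after finitely many steps and outputs a greatest common divisor of $f(x)$ and $g(x)$ in $\mathbb{Z}[x]$.
   Context: Notation. For a non-zero polynomial $u(x)=u_0x^n+\cdots+u_n\in\mathbb{Z}[x]$ with $u_0\neq0$: $\mathrm{lc}(u)=u_0$; $\|u\|=\sqrt{\sum_{i=0}^n u_i^2}$; $\mathrm{cont}(u)$ is the gcd of the coefficients, with sign chosen equal to the sign of $\mathrm{lc}(u)$; $\mathrm{pp}(u)=u/\mathrm{cont}(u)$. Greatest common divisors in $\mathbb{Z}[x]$ are defined up to sign. For a prime $p$, $u_p(x)\in\mathbb{Z}_p[x]$ is the coefficientwise reduction of $u$ modulo $p$, where $\mathbb{Z}_p=\{0,\dots,p-1\}$ is the field of residues modulo $p$. Reconstruction: for $v(x)\in\mathbb{Z}_p[x]$, its reconstructed pre-image is the polynomial in $\mathbb{Z}[x]$ obtained by replacing each coefficient $b\in\{0,\dots,p-1\}$ of $v$ by $b$ if $b<p/2$ and by $b-p$ otherwise. Procedure BPN-e on input $f,g$: (1) Set $r=\gcd(\mathrm{cont}(f),\mathrm{cont}(g))\in\mathbb{Z}$, and replace $f$ by $\mathrm{pp}(f)$ and $g$ by $\mathrm{pp}(g)$. (2) Set $a_0=\mathrm{lc}(f)>0$, $b_0=\mathrm{lc}(g)>0$, $w=\gcd(a_0,b_0)>0$, and $D=\min\{\deg f,\deg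 g\}+1$. (3) Choose a prime $q\nmid w$, compute a gcd $e_q(x)$ of $f_q(x),g_q(x)$ in $\mathbb{Z}_q[x]$, set $s=\deg e_q(x)$ and $$M=2^{s}\cdot w\cdot\min\left\{\frac{\|f\|}{a_0},\frac{\|g\|}{b_0}\right\}.$$ (4) Choose a new prime $p>2M$ (different from all main primes chosen before). Compute a gcd $e_p(x)$ of $f_p(x),g_p(x)$ in $\mathbb{Z}_p[x]$ by the Euclidean algorithm. (5) If $D\le\deg e_p(x)$, go to (4). (6) Otherwise choose $t\in\mathbb{Z}_p$ with $\mathrm{lc}(t\cdot e_p(x))=w$ in $\mathbb{Z}_p$, let $k(x)\in\mathbb{Z}[x]$ be the reconstructed pre-image of $t\cdot e_p(x)$, and set $d(x)=\mathrm{pp}(k(x))$. (7) If $d(x)\mid f(x)$ and $d(x)\mid g(x)$ in $\mathbb{Z}[x]$, output $r\cdot d(x)$ and stop. Otherwise set $D=\deg e_p(x)$ and go to (4). *)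

(* Defs.v *)
From mathcomp Require Import all_boot all_order all_algebra.
From mathcomp Require Import realalg.
From Stdlib Require Import Relation_Operators.

Set Implicit Arguments.
Unset Strict Implicit.
Unset Printing Implicit Defensive.

Import Order.TTheory GRing.Theory Num.Theory.
Local Open Scope ring_scope.

(* MathComp's %| on {poly int} is pseudo-divisibility (divisibility over the
   rationals), so divisibility in the ring itself is defined here. *)
Definition divides (A : comNzRingType) (d u : A) : Prop :=
  exists h : A, u = h * d.

Definition is_gcd (A : comNzRingType) (d u v : A) : Prop :=
  [/\ divides d u, divides d v &
      forall c : A, divides c u -> divides c v -> divides c d].

Definition deg (A : nzSemiRingType) (u : {poly A}) : nat := (size u).-1.

Definition l2norm (u : {poly int}) : realalg :=
  Num.sqrt (\sum_(i < size u) (u`_i)%:~R ^+ 2).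

Definition reduce (p : nat) (u : {poly int}) : {poly 'F_p} :=
  map_poly (intr : int -> 'F_p) u.

Definition symmetric_residue (p : nat) (b : 'F_p) : int :=
  if (b.*2 < p)%N then b%:Z else b%:Z - p%:Z.

Definition reconstruct (p : nat) (v : {poly 'F_p}) : {poly int} :=
  map_poly (@symmetric_residue p) v.

(* The values that stay fixed once the main loop is entered; [bf] and [bg] are
   the primitive parts of the inputs. *)
Record params := Params {
  br : int;
  bf : {poly int};
  bg : {poly int};
  bw : int;
  bM : realalg
}.

(* Program points of BPN-e with the values of the live variables. [ps] lists
   all the main primes chosen so far, including those discarded because the
   degree of the modular gcd was not smaller than [D]. *)
Inductive state :=
| Start (f g : {poly int})
| Bounds (r : int) (f g : {poly int})
| ChooseAux (r : int) (f g : {poly int}) (w : int) (D : nat)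
| ChooseMain (c : params) (ps : seq nat) (D : nat)
| TestDegree (c : params) (ps : seq nat) (D p : nat) (e : {poly 'F_p})
| Lift (c : params) (ps : seq nat) (p : nat) (e : {poly 'F_p})
| TestDivision (c : params) (ps : seq nat) (p : nat) (e : {poly 'F_p})
    (d : {poly int})
| Output (h : {poly int}).

(* The nondeterminism consists of the primes q and p, the representatives of
   the modular gcds, and t. For f <> 0, [zcontents f] carries the sign of the
   leading coefficient, so [zprimitive f] has a positive one. *)
Definition step (s s' : state) : Prop :=
  match s with
  | Start f g =>
      s' = Bounds (gcdz (zcontents f) (zcontents g))
             (zprimitive f) (zprimitive g)
  | Bounds r f g =>
      s' = ChooseAux r f g (gcdz (lead_coef f) (lead_coef g))
             (minn (deg f) (deg g)).+1
  | ChooseAux r f g w D =>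
      exists (q : nat) (e : {poly 'F_q}),
        [/\ prime q, ~~ (q%:Z %| w)%Z, is_gcd e (reduce q f) (reduce q g) &
            let M := 2 ^+ deg e * w%:~R *
                     Num.min (l2norm f / (lead_coef f)%:~R)
                             (l2norm g / (lead_coef g)%:~R) in
            s' = ChooseMain (Params r f g w M) [::] D]
  | ChooseMain c ps D =>
      exists (p : nat) (e : {poly 'F_p}),
        [/\ prime p, p \notin ps, 2 * bM c < p%:R,
            is_gcd e (reduce p (bf c)) (reduce p (bg c)) &
            s' = TestDegree c (p :: ps) D e]
  | TestDegree c ps D p e =>
      s' = if (D <= deg e)%N then ChooseMain c ps D else Lift c ps e
  | Lift c ps p e =>
      exists t : 'F_p,
        lead_coef (t *: e) = (bw c)%:~R /\
        s' = TestDivision c ps e (zprimitive (reconstruct (t *: e)))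
  | TestDivision c ps p e d =>
      (divides d (bf c) /\ divides d (bg c) /\ s' = Output (br c *: d)) \/
      (~ (divides d (bf c) /\ divides d (bg c)) /\
       s' = ChooseMain c ps (deg e))
  | Output _ => False
  end.

Definition reachable : state -> state -> Prop := clos_refl_trans state step.

Definition halted (s : state) : Prop := forall s' : state, ~ step s s'.

(* No infinite execution starts in s, whatever choices are made. *)
Definition terminates (s : state) : Prop := Acc (fun s2 s1 => step s1 s2) s.

(* Main.v *)
Require Import Defs.
From mathcomp Require Import all_boot all_order all_algebra.
From mathcomp Require Import all_field realalg ring zify.

Set Implicit Arguments.
Unset Strict Implicit.
Unset Printing Implicit Defensive.

Import Order.TTheory GRing.Theory Num.Theory.
Local Open Scope ring_scope.

(** Let f and g be primitive with positive leading coefficients, let h be their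
    primitive greatest common divisor [zgcd f g], and let w be the gcd of the
    leading coefficients. Since lead h divides w, no prime p that does not
    divide w divides lead h, so h keeps its degree modulo p and divides the
    modular gcd e; thus deg h <= deg e ([modgcd_multiple]).

    This inequality makes every output correct. A candidate d is the
    primitive part of a lift of a scalar multiple of e, and lifting preserves
    degrees. If d divides f and g, it divides h and has degree at least deg h,
    so d = h ([candidate_eq_zgcd], second case).

    Termination rests on two facts. First, only finitely many primes p are
    unlucky, that is, have deg e > deg h: a Bezout relation
    a (f / h) + b (g / h) = R with a nonzero integer R shows that they divide R
    ([unlucky_primes_divide]). Second, a lucky prime always succeeds. Indeed, the
    normalised modular gcd is then the reduction of k = (w / lead h) h, and
    the auxiliary modular gcd gives deg h <= s, so Mignotte's inequality bounds
    the coefficients of k by M < p / 2, and the symmetric residues recover k,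
    whose primitive part is h ([candidate_eq_zgcd], first case). So each
    iteration that does not lead to an output uses up a prime divisor of R, and
    the main primes are distinct ([loop_terminates]).

    Mignotte's inequality is obtained over the complex numbers from Landau's
    bound of the Mahler measure by the Euclidean norm ([landau]). *)

(** * Landau's and Mignotte's inequalities *)

Definition sqnorm (C : numClosedFieldType) (n : nat) (u : {poly C}) : C :=
  \sum_(i < n) `|u`_i| ^+ 2.

(** The contribution max(1, |z|) of the root z to the Mahler measure. *)
Definition clip (C : numClosedFieldType) (z : C) : C :=
  if `|z| <= 1 then 1 else `|z|.

Lemma clip_ge1 (C : numClosedFieldType) (z : C) : 1 <= clip z.
Proof.
rewrite /clip; case: ifP => // /negbT; rewrite -real_ltNge ?rpred1 ?normr_real //.
exact: ltW.
Qed.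

Lemma clip_ge_norm (C : numClosedFieldType) (z : C) : `|z| <= clip z.
Proof. by rewrite /clip; case: ifP. Qed.

Lemma prod_clip_ge1 (C : numClosedFieldType) (rs : seq C) :
  1 <= \prod_(z <- rs) clip z.
Proof.
elim/big_rec: _ => // z x _ hx; rewrite -[1]mulr1.
by apply: ler_pM => //; apply: clip_ge1.
Qed.

(** The factor on the right has the mirror image 1 / z^* of z in the unit circle
    as its root. The two sums differ termwise by (|z|^2 - 1) times
    |u_i|^2 - |u_(i-1)|^2, which telescopes to 0. *)
Lemma sqnorm_flip (C : numClosedFieldType) (z : C) (u : {poly C}) (n : nat) :
  (size u <= n)%N ->
  sqnorm n.+1 (('X - z%:P) * u) = sqnorm n.+1 ((z^* *: 'X - 1) * u).
Proof.
move=> su; apply/eqP; rewrite -subr_eq0 /sqnorm -sumrB.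
pose v i := if i is j.+1 then `|u`_j| ^+ 2 else 0.
have E (i : 'I_n.+1) : true ->
  `|(('X - z%:P) * u)`_i| ^+ 2 - `|((z^* *: 'X - 1) * u)`_i| ^+ 2
  = (`|z| ^+ 2 - 1) * (v i.+1 - v i).
  move=> _; rewrite !mulrBl mul1r -scalerAl !coefB coefZ coefXM coefCM /v.
  case: (nat_of_ord i) => [|j] /=.
    by rewrite mulr0 !sub0r !normrN normrM exprMn subr0; ring.
  rewrite !normCK !(rmorphB, rmorphM) /= conjCK; ring.
rewrite (eq_bigr _ E) -mulr_sumr.
rewrite -(big_mkord xpredT (fun i => v i.+1 - v i)) telescope_sumr // /v.
by rewrite nth_default // normr0 expr0n subr0 mulr0.
Qed.

(** Roots outside the unit circle are flipped one at a time, which keeps the norm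
    and multiplies the absolute value of the top coefficient by |z|; in the end
    that coefficient is a single term of the norm. In the induction u absorbs
    the factors already treated. *)
Lemma landau (C : numClosedFieldType) (rs : seq C) (u : {poly C}) (n : nat) :
  (size u <= n.+1)%N ->
  (`|u`_n| * \prod_(z <- rs) clip z) ^+ 2
    <= sqnorm (n + size rs).+1 (u * \prod_(z <- rs) ('X - z%:P)).
Proof.
elim: rs u n => [|z rs IH] u n su.
  rewrite !big_nil !mulr1 addn0 /sqnorm big_ord_recr /= lerDr.
  by apply: sumr_ge0 => i _; apply: exprn_ge0.
have step (v : {poly C}) : (size v <= 2)%N -> `|v`_1| = clip z ->
  (`|u`_n| * \prod_(z0 <- z :: rs) clip z0) ^+ 2
    <= sqnorm (n + size (z :: rs)).+1 (v * (u * \prod_(z0 <- rs) ('X - z0%:P))).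
  move=> sv Ev; rewrite big_cons mulrCA -Ev [in X in X <= _]mulrA -normrM.
  rewrite [v * _]mulrA /= addnS -addSn.
  have -> : v`_1 * u`_n = (v * u)`_n.+1.
    rewrite coefM big_ord_recl big_ord_recl big1 /= => [|i _]; last first.
      by rewrite nth_default ?mul0r //; apply: leq_trans sv _.
    by rewrite subn0 (nth_default _ su) mulr0 add0r addr0 /bump /= subSS subn0.
  apply: IH; apply: leq_trans (size_polyMleq _ _) _.
  by move: (leq_add sv su); case: (_ + _)%N.
have [z1|z1] := boolP (`|z| <= 1).
  rewrite [in X in sqnorm _ X]big_cons /= mulrCA; apply: step.
    by rewrite size_XsubC.
  by rewrite /clip z1 coefB coefX coefC subr0 normr1.
rewrite [in X in sqnorm _ X]big_cons /= mulrCA.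
rewrite addnS sqnorm_flip; first (rewrite -addnS; apply: step).
- apply: leq_trans (size_polyD _ _) _; rewrite size_polyN size_poly1 geq_max andbT.
  by apply: leq_trans (size_scale_leq _ _) _; rewrite size_polyX.
- by rewrite /clip (negbTE z1) coefB coefZ coefX coefC subr0 mulr1 norm_conjC.
apply: leq_trans (size_polyMleq _ _) _.
by rewrite size_prod_XsubC addnS /= -addSn addSn -addSn leq_add2r.
Qed.

(** The coefficient of index i+1 of (X - z) u is u_i - z u_(i+1), so each factor
    costs at most 1 + |z| <= 2 max(1, |z|). *)
Lemma coef_prod_XsubC_le (C : numClosedFieldType) (rs : seq C) (i : nat) :
  `|(\prod_(z <- rs) ('X - z%:P))`_i| <= 2 ^+ size rs * \prod_(z <- rs) clip z.
Proof.
elim: rs i => [|z rs IH] i.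
  by rewrite !big_nil mulr1 coefC; case: eqP; rewrite ?normr1 ?normr0.
rewrite !big_cons mulrBl coefB coefXM coefCM exprS mulrACA (mulrC 2) mulr_natr mulrDl.
set P := _ * \prod_(j <- rs) _.
have P0 : 0 <= P by apply: le_trans (IH 0%N).
have c0 : 0 <= clip z by apply: le_trans (clip_ge1 z).
apply: le_trans (ler_normB _ _) _; apply: lerD; last first.
  by rewrite normrM; apply: ler_pM => //; apply: clip_ge_norm.
case: eqP => _; first by rewrite normr0 mulr_ge0.
by apply: le_trans (IH _) _; rewrite ler_peMl // clip_ge1.
Qed.

(** Mignotte's inequality, squared so as to be a statement about integers: the
    Mahler measure divided by the absolute value of the leading coefficient is
    at most as large for h as for u * h, which has further roots. *)
Lemma mignotte (h u : {poly int}) (i : nat) : h != 0 -> u != 0 ->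
  (lead_coef (u * h) * h`_i) ^+ 2
    <= (2 ^+ deg h * lead_coef h) ^+ 2
       * \sum_(j < size (u * h)) (u * h)`_j ^+ 2.
Proof.
move=> h0 u0; rewrite -(ler_int algC).
have sqZ (x : int) : (x ^+ 2)%:~R = `|x%:~R| ^+ 2 :> algC.
  by rewrite rmorphXn /= real_normK // realz.
pose ZC : {poly int} -> {poly algC} := map_poly intr.
have lZ v : lead_coef (ZC v) = (lead_coef v)%:~R.
  by rewrite lead_coef_map_inj //; apply: intr_inj.
have sZ v : size (ZC v) = size v by rewrite size_map_inj_poly //; apply: intr_inj.
have [rs Hrs] := closed_field_poly_normal (ZC h).
have [ss Hss] := closed_field_poly_normal (ZC u).
have lh0 : lead_coef (ZC h) != 0 by rewrite lZ intr_eq0 lead_coef_eq0.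
have lu0 : lead_coef (ZC u) != 0 by rewrite lZ intr_eq0 lead_coef_eq0.
have srs : size h = (size rs).+1.
  by rewrite -sZ Hrs size_scale // size_prod_XsubC.
have sss : size u = (size ss).+1.
  by rewrite -sZ Hss size_scale // size_prod_XsubC.
pose c : algC := (lead_coef (u * h))%:~R.
have cE : c = lead_coef (ZC u) * lead_coef (ZC h).
  by rewrite /c lead_coefM intrM -!lZ.
have EF : c%:P * \prod_(z <- ss ++ rs) ('X - z%:P) = ZC (u * h).
  rewrite /ZC rmorphM /= -/(ZC u) -/(ZC h) Hrs Hss -scalerAl -scalerAr scalerA.
  by rewrite big_cat /= cE mul_polyC.
have := landau (ss ++ rs) (size_polyC_leq1 c).
rewrite EF coefC eqxx add0n.
have -> : (size (ss ++ rs)).+1 = size (u * h).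
  by rewrite size_mul // srs sss addnS size_cat.
have -> : sqnorm (size (u * h)) (ZC (u * h)) =
  (\sum_(j < size (u * h)) (u * h)`_j ^+ 2)%:~R.
  by rewrite rmorph_sum /=; apply: eq_bigr => j _; rewrite coef_map /= sqZ.
move=> L; rewrite sqZ [X in _ <= X]intrM.
apply: le_trans (ler_wpM2l _ L); last by rewrite ler0z sqr_ge0.
rewrite sqZ -exprMn !intrM !normrM -/c -lZ rmorphXn /= normrX normr_nat /deg srs /=.
have P0 : 0 <= \prod_(z <- rs) clip z by rewrite (le_trans _ (prod_clip_ge1 rs)).
rewrite lerXn2r ?nnegrE ?mulr_ge0 ?exprn_ge0 ?(le_trans _ (prod_clip_ge1 _)) //.
rewrite [X in _ <= X]mulrCA; apply: ler_wpM2l => //.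
rewrite -[(h`_i)%:~R](coef_map (intr : int -> algC)) -/(ZC h) Hrs coefZ -Hrs normrM.
rewrite [2 ^+ _ * _]mulrC -mulrA; apply: ler_wpM2l => //.
apply: le_trans (coef_prod_XsubC_le _ _) _.
by rewrite ler_wpM2l ?exprn_ge0 // big_cat /= ler_peMl // prod_clip_ge1.
Qed.

(** * Greatest common divisors in Z[x] *)

Definition zgcd (f g : {poly int}) : {poly int} := zprimitive (gcdp f g).

Lemma lead_zprimitive_gt0 (u : {poly int}) : u != 0 -> 0 < lead_coef (zprimitive u).
Proof. by move=> u0; rewrite -sgz_gt0 sgz_lead_primitive u0. Qed.

(** Gauss's lemma: for a primitive divisor, divisibility in Z[x] agrees with
    divisibility over the rationals. *)
Lemma zprimitive_divides (d u : {poly int}) : divides (zprimitive d) u <-> d %| u.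
Proof.
split=> [[k ->]|/dvdpP_int[k ->]]; last by exists k; rewrite mulrC.
rewrite dvdp_mull //; have [->|d0] := eqVneq d 0; first by rewrite zprimitive0.
by rewrite [X in X %| _]zpolyEprim dvdpZl ?zcontents_eq0.
Qed.

Lemma zgcd_neq0 (f g : {poly int}) : f != 0 -> zgcd f g != 0.
Proof. by move=> f0; rewrite zprimitive_eq0 gcdp_eq0 (negbTE f0). Qed.

(** Dividing the Bezout relation over the rationals by the gcd leaves a nonzero
    constant; clearing denominators makes it the integer R. *)
Lemma zgcd_bezout (f g : {poly int}) : f != 0 ->
  exists f1 g1 a b (R : int),
    [/\ f = f1 * zgcd f g, g = g1 * zgcd f g, R != 0 & a * f1 + b * g1 = R%:P].
Proof.
move=> f0; set h := zgcd f g.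
have h0 : h != 0 := zgcd_neq0 g f0.
have [f1 E1] : divides h f by apply/zprimitive_divides/dvdp_gcdl.
have [g1 E2] : divides h g by apply/zprimitive_divides/dvdp_gcdr.
have [[u v] /= /eqpP[[c1 c2] /= /andP[c10 c20] E]] := Bezoutp f g.
exists f1, g1, (c1 *: u), (c1 *: v), (c2 * zcontents (gcdp f g)); split => //.
  by rewrite mulf_neq0 // zcontents_eq0 gcdp_eq0 (negbTE f0).
apply: (mulIf h0); rewrite mulrDl -!mulrA -E1 -E2 -!scalerAl -scalerDr E.
by rewrite mul_polyC -scalerA -zpolyEprim.
Qed.

(** Contents and primitive parts are multiplicative, so a gcd is the product of
    the gcd of the contents and the gcd of the primitive parts. *)
Lemma is_gcd_zgcd (f g : {poly int}) :
  is_gcd (gcdz (zcontents f) (zcontents g) *: zgcd (zprimitive f) (zprimitive g)) f g.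
Proof.
set r := gcdz _ _; set h := zgcd _ _.
have div u : (r %| zcontents u)%Z -> divides h (zprimitive u) -> divides (r *: h) u.
  move=> /dvdzP[k Ek] [v Ev]; exists (k *: v).
  by rewrite -scalerAl -scalerAr scalerA -Ek -Ev -zpolyEprim.
split.
- by apply: div; [apply: dvdz_gcdl | apply/zprimitive_divides/dvdp_gcdl].
- by apply: div; [apply: dvdz_gcdr | apply/zprimitive_divides/dvdp_gcdr].
move=> c [x Ex] [y Ey].
have : (zcontents c %| r)%Z.
  by rewrite /r dvdz_gcd {1}Ex {1}Ey !zcontentsM; apply/andP; split; apply: dvdz_mull.
have : zprimitive c %| gcdp (zprimitive f) (zprimitive g).
  by rewrite dvdp_gcd Ex Ey !zprimitiveM !dvdp_mull.
move=> /dvdpP_int[z Ez] /dvdzP[m Em].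
exists (m *: zprimitive z); rewrite Em /h /zgcd Ez zprimitive_id zprimitiveM
  zprimitive_id.
by rewrite -scalerA -scalerAl mulrC scalerAr -zpolyEprim.
Qed.

Lemma zprimitive_dvd_eq (d h : {poly int}) : h != 0 ->
  zprimitive d = d -> zprimitive h = h -> d %| h -> (size h <= size d)%N -> d = h.
Proof.
move=> h0 pd ph /dvdpP_int[k]; rewrite pd => E sdh.
have k0 : k != 0 by apply: contraNneq h0 => k0; rewrite E k0 mulr0.
have d0 : d != 0 by apply: contraNneq h0 => d0; rewrite E d0 mul0r.
have /size_poly1P[c c0 Ec] : size k == 1%N.
  move: sdh; rewrite E size_mul // -[size d]prednK ?size_poly_gt0 // addSn /=.
  by rewrite -[X in (_ <= X)%N]addn1 leq_add2l eqn_leq size_poly_gt0 k0 => ->.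
by rewrite -ph E Ec mulrC mul_polyC zprimitiveZ // pd.
Qed.

Lemma zgcd_divl (f g : {poly int}) : divides (zgcd f g) f.
Proof. by apply/zprimitive_divides/dvdp_gcdl. Qed.

Lemma zgcd_divr (f g : {poly int}) : divides (zgcd f g) g.
Proof. by apply/zprimitive_divides/dvdp_gcdr. Qed.

Lemma lead_zgcd_dvd (f g : {poly int}) :
  exists v, gcdz (lead_coef f) (lead_coef g) = v * lead_coef (zgcd f g).
Proof.
apply/dvdzP; have [u Eu] := zgcd_divl f g; have [v Ev] := zgcd_divr f g.
rewrite dvdz_gcd; apply/andP; split.
  by rewrite {1}Eu lead_coefM; apply: dvdz_mull.
by rewrite {1}Ev lead_coefM; apply: dvdz_mull.
Qed.

Lemma dvdp_zgcd (d f g : {poly int}) : f != 0 ->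
  (d %| zgcd f g) = (d %| f) && (d %| g).
Proof.
move=> f0; rewrite -dvdp_gcd [in RHS](zpolyEprim (gcdp f g)) dvdpZr //.
by rewrite zcontents_eq0 gcdp_eq0 (negbTE f0).
Qed.

(** * Greatest common divisors modulo a prime *)

Lemma intr_Fp_eq0 (p : nat) (x : int) : prime p ->
  ((x%:~R : 'F_p) == 0) = (p%:Z %| x)%Z.
Proof. by move=> /pchar_Fp /dvdz_pcharf ->. Qed.

Lemma symmetric_residue_intr (p : nat) (x : int) : prime p ->
  (2 * `|x| < p)%N -> symmetric_residue (x%:~R : 'F_p) = x.
Proof.
move=> pp xp; have p0 := prime_gt0 pp.
rewrite /symmetric_residue; case: x xp => n xp.
  by rewrite -[n%:~R]/(n%:R) val_Fp_nat // modn_small; [case: ifP => //|]; lia.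
rewrite NegzE in xp *.
have -> : (- n.+1%:Z)%:~R = (p - n.+1)%:R :> 'F_p.
  by rewrite natrB ?pchar_Fp_0 // ?rmorphN ?sub0r //; lia.
rewrite val_Fp_nat // modn_small; last lia.
by case: ifP; lia.
Qed.

Lemma reconstruct_reduce (p : nat) (u : {poly int}) : prime p ->
  (forall i, (2 * `|(u`_i)%R| < p)%N) -> reconstruct (reduce p u) = u.
Proof.
move=> pp up; apply/polyP => i; rewrite /reconstruct coef_map_id0; last first.
  by rewrite -[0]/(0%:~R) symmetric_residue_intr // prime_gt0.
by rewrite coef_map /= symmetric_residue_intr.
Qed.

(** A nonzero residue has a nonzero lift, so the leading coefficient survives. *)
Lemma size_reconstruct (p : nat) (v : {poly 'F_p}) : prime p ->
  size (reconstruct v) = size v.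
Proof.
move=> pp; have [->|v0] := eqVneq v 0.
  by rewrite /reconstruct map_poly0 !size_poly0.
rewrite size_map_poly_id0 //; rewrite -lead_coef_eq0 in v0.
move: (lead_coef v) v0 => b; rewrite -val_eqE /= -lt0n /symmetric_residue.
have := ltn_ord b; rewrite [X in (_ < X)%N -> _]Fp_cast //.
by case: ifP; lia.
Qed.

Lemma is_gcd_gcdp (F : fieldType) (u v : {poly F}) : is_gcd (gcdp u v) u v.
Proof.
split; try by apply/dvdpP; rewrite ?dvdp_gcdl ?dvdp_gcdr.
by move=> c /dvdpP cu /dvdpP cv; apply/dvdpP; rewrite dvdp_gcd cu cv.
Qed.

Lemma reduce_divides (p : nat) (d u : {poly int}) :
  divides d u -> divides (reduce p d) (reduce p u).
Proof. by move=> [k ->]; exists (reduce p k); rewrite /reduce rmorphM. Qed.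

Lemma lead_coef_divisor_unit (p : nat) (f g h : {poly int}) : prime p ->
  ~~ (p%:Z %| gcdz (lead_coef f) (lead_coef g))%Z ->
  divides h f -> divides h g -> (lead_coef h)%:~R != 0 :> 'F_p.
Proof.
move=> pp pw [k Ek] [l El]; rewrite intr_Fp_eq0 //; apply: contra pw => ph.
by rewrite dvdz_gcd Ek El !lead_coefM; apply/andP; split; apply: dvdz_mull.
Qed.

Lemma modgcd_neq0 (p : nat) (f g : {poly int}) (e : {poly 'F_p}) : prime p ->
  ~~ (p%:Z %| gcdz (lead_coef f) (lead_coef g))%Z ->
  is_gcd e (reduce p f) (reduce p g) -> e != 0.
Proof.
move=> pp pw [[k Ek] [l El] _]; apply: contra pw => /eqP e0.
have red0 u : reduce p u = 0 -> (p%:Z %| lead_coef u)%Z.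
  by move=> u0; rewrite -intr_Fp_eq0 // -(coef_map (intr : int -> 'F_p)) -/(reduce p u) u0
    coef0.
by rewrite dvdz_gcd !red0 // ?Ek ?El e0 mulr0.
Qed.

(** As lead h divides the gcd of the leading coefficients, it survives reduction,
    and the reduction of h is a common divisor of the same degree. *)
Lemma modgcd_multiple (p : nat) (f g h : {poly int}) (e : {poly 'F_p}) : prime p ->
  ~~ (p%:Z %| gcdz (lead_coef f) (lead_coef g))%Z ->
  divides h f -> divides h g -> is_gcd e (reduce p f) (reduce p g) ->
  [/\ size (reduce p h) = size h, reduce p h %| e & (size h <= size e)%N].
Proof.
move=> pp pw hf hg He; have e0 := modgcd_neq0 pp pw He.
have sh : size (reduce p h) = size h.
  by apply: size_map_poly_id0; apply: lead_coef_divisor_unit pp pw hf hg.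
have he : reduce p h %| e.
  by case: He => _ _ /(_ _ (reduce_divides p hf) (reduce_divides p hg)) /dvdpP.
by split=> //; rewrite -sh dvdp_leq.
Qed.

(** Modulo p the constant R is invertible, so the reduced Bezout relation shows
    that e divides the reduction of h. *)
Lemma modgcd_size_good (p : nat) (f1 g1 a b h : {poly int}) (R : int)
    (e : {poly 'F_p}) : prime p ->
  ~~ (p%:Z %| gcdz (lead_coef (f1 * h)) (lead_coef (g1 * h)))%Z ->
  a * f1 + b * g1 = R%:P -> ~~ (p%:Z %| R)%Z ->
  is_gcd e (reduce p (f1 * h)) (reduce p (g1 * h)) -> size e = size h.
Proof.
move=> pp pw E pR He.
have hf : divides h (f1 * h) by exists f1.
have hg : divides h (g1 * h) by exists g1.
have [sh _ sle] := modgcd_multiple pp pw hf hg He.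
apply/eqP; rewrite eqn_leq sle andbT -sh.
have h0 : reduce p h != 0.
  rewrite -size_poly_gt0 sh size_poly_gt0 -lead_coef_eq0.
  by have := lead_coef_divisor_unit pp pw hf hg; apply: contraNneq => ->.
apply: dvdp_leq => //; case: He => /dvdpP ef /dvdpP eg _.
rewrite -intr_Fp_eq0 // in pR.
rewrite -(dvdpZr _ _ pR) -mul_polyC.
have <- : reduce p (a * (f1 * h) + b * (g1 * h)) = (R%:~R)%:P * reduce p h.
  by rewrite !mulrA -mulrDl E /reduce rmorphM /= map_polyC.
by rewrite /reduce rmorphD !rmorphM dvdp_add // dvdp_mull // -/(reduce p _) -rmorphM.
Qed.

(** With equal degrees, e is a scalar multiple of the reduction of h, and the
    prescribed leading coefficient determines the scalar. *)
Lemma modgcd_lift (p : nat) (f g h : {poly int}) (v : int) (e : {poly 'F_p}) (t : 'F_p) :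
  prime p -> ~~ (p%:Z %| gcdz (lead_coef f) (lead_coef g))%Z ->
  divides h f -> divides h g -> is_gcd e (reduce p f) (reduce p g) ->
  size e = size h -> lead_coef (t *: e) = (v * lead_coef h)%:~R ->
  t *: e = reduce p (v *: h).
Proof.
move=> pp pw hf hg He se.
have e0 := modgcd_neq0 pp pw He.
have [sh /dvdpP[k Ek] _] := modgcd_multiple pp pw hf hg He.
have lh := lead_coef_divisor_unit pp pw hf hg.
have lE : lead_coef (reduce p h) = (lead_coef h)%:~R by apply: lead_coef_map_id0.
have k0 : k != 0 by apply: contraNneq e0 => k0; rewrite Ek k0 mul0r.
have h0 : reduce p h != 0 by apply: contraNneq e0 => h0; rewrite Ek h0 mulr0.
have /size_poly1P[c _ Ec] : size k == 1%N.
  move: se; rewrite -sh Ek size_mul // -[size (reduce p h)]prednK ?size_poly_gt0 //.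
  by rewrite addnS /= -[X in _ = X]add1n => /addIn ->.
rewrite Ek Ec mul_polyC scalerA lead_coefZ lE rmorphM /= => /(mulIf lh) ->.
by rewrite /reduce map_polyZ.
Qed.

(** * The coefficient bound M *)

Lemma sqr_l2norm (u : {poly int}) :
  l2norm u ^+ 2 = (\sum_(i < size u) u`_i ^+ 2)%:~R.
Proof.
rewrite sqr_sqrtr; first by rewrite rmorph_sum; apply: eq_bigr => i _; rewrite rmorphXn.
by apply: sumr_ge0 => i _; apply: sqr_ge0.
Qed.

(** For v = w / lead h this bounds the coefficients of (w / lead h) h, the
    polynomial that a lucky prime has to recover. *)
Lemma mignotte_scaled (f h : {poly int}) (v : int) (i : nat) : 0 < lead_coef f ->
  divides h f -> 0 <= v * lead_coef h ->
  `|v * h`_i|%:~R <=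
    2 ^+ deg h * (v * lead_coef h)%:~R * (l2norm f / (lead_coef f)%:~R).
Proof.
move=> lf [u E] w0.
have f0 : f != 0 by rewrite -lead_coef_eq0 gt_eqF.
have h0 : h != 0 by apply: contraNneq f0 => h0; rewrite E h0 mulr0.
have u0 : u != 0 by apply: contraNneq f0 => u0; rewrite E u0 mul0r.
rewrite mulrA ler_pdivlMr ?ltr0z //.
have n0 : 0 <= l2norm f := sqrtr_ge0 _.
have key : (`|v * h`_i| * lead_coef f) ^+ 2
    <= (2 ^+ deg h * (v * lead_coef h)) ^+ 2 * \sum_(j < size f) f`_j ^+ 2.
  rewrite exprMn real_normK ?num_real //.
  have := ler_wpM2l (sqr_ge0 v) (mignotte i h0 u0); rewrite -E.
  set S := \sum_(_ < _) _; move: (2 ^+ _) => m; congr (_ <= _); ring.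
rewrite -ler_sqr ?nnegrE ?mulr_ge0 ?ler0z ?exprn_ge0 ?(ltW lf) //.
rewrite [X in _ <= X]exprMn sqr_l2norm.
by move: key; rewrite -(ler_int realalg) rmorphXn rmorphM [X in _ <= X]intrM
  rmorphXn rmorphM rmorphXn.
Qed.

Lemma aux_bound (f g h : {poly int}) (v : int) (s i p : nat) :
  0 < lead_coef f -> 0 < lead_coef g -> divides h f -> divides h g ->
  0 <= v * lead_coef h -> (deg h <= s)%N ->
  2 * (2 ^+ s * (v * lead_coef h)%:~R *
       Num.min (l2norm f / (lead_coef f)%:~R) (l2norm g / (lead_coef g)%:~R))
    < p%:R :> realalg ->
  (2 * `|((v *: h)`_i)%R| < p)%N.
Proof.
move=> lf lg hf hg w0 hs; set m := Num.min _ _ => pM.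
have m0 : 0 <= m by rewrite le_min !divr_ge0 ?sqrtr_ge0 ?ler0z ?ltW.
have wR : 0 <= (v * lead_coef h)%:~R :> realalg by rewrite ler0z.
have B : `|v * h`_i|%:~R <= 2 ^+ deg h * (v * lead_coef h)%:~R * m.
  by rewrite /m; case: (leP (l2norm f / _)) => _; apply: mignotte_scaled.
have B2 : 2 ^+ deg h * (v * lead_coef h)%:~R * m <= 2 ^+ s * (v * lead_coef h)%:~R * m.
  by rewrite !ler_wpM2r // ler_eXn2l // ltr1n.
rewrite coefZ -(ltr_nat realalg) natrM; apply: le_lt_trans pM.
rewrite ler_wpM2l //; apply: le_trans B2; apply: le_trans B.
by rewrite -abszE -[X in _ <= X]pmulrn.
Qed.

(** * Main primes and candidates *)

(** M depends on the auxiliary modular gcd through its degree s alone; that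
    deg h <= s is what makes M large enough. *)
Definition loop_params (r : int) (f g : {poly int}) (c : params) : Prop :=
  [/\ br c = r, bf c = f, bg c = g, bw c = gcdz (lead_coef f) (lead_coef g) &
      exists2 s, (deg (zgcd f g) <= s)%N &
        bM c = 2 ^+ s * (bw c)%:~R *
               Num.min (l2norm f / (lead_coef f)%:~R)
                       (l2norm g / (lead_coef g)%:~R)].

Definition main_choice (f g : {poly int}) (c : params) (p : nat)
    (e : {poly 'F_p}) : Prop :=
  [/\ prime p, 2 * bM c < p%:R & is_gcd e (reduce p f) (reduce p g)].

(** The bound on the top coefficient of v h, which is w itself, gives 2 w < p;
    this is why a main prime never divides w. *)
Lemma main_choice_large (r : int) (f g : {poly int}) (c : params) (p : nat)
    (e : {poly 'F_p}) (v : int) :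
  0 < lead_coef f -> 0 < lead_coef g -> loop_params r f g c ->
  main_choice f g c e ->
  gcdz (lead_coef f) (lead_coef g) = v * lead_coef (zgcd f g) ->
  (forall i, (2 * `|((v *: zgcd f g)`_i)%R| < p)%N) /\
  ~~ (p%:Z %| gcdz (lead_coef f) (lead_coef g))%Z.
Proof.
move=> lf lg [_ _ _ Ew [s hs EM]] [pp pM _] Ev.
have w0 : 0 < gcdz (lead_coef f) (lead_coef g).
  by rewrite lt_def gcdz_eq0 (gt_eqF lf).
have B i : (2 * `|((v *: zgcd f g)`_i)%R| < p)%N.
  apply: (aux_bound _ lf lg (zgcd_divl f g) (zgcd_divr f g) _ hs).
    by rewrite -Ev ltW.
  by rewrite -Ev -Ew -EM.
split=> //; have := B (deg (zgcd f g)).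
rewrite coefZ -/(lead_coef _) -Ev => wp; rewrite dvdzE.
by apply/negP => /dvdn_leq; move: (gcdz _ _) w0 wp => w; lia.
Qed.

Lemma main_choice_size (r : int) (f g : {poly int}) (c : params) (p : nat)
    (e : {poly 'F_p}) :
  0 < lead_coef f -> 0 < lead_coef g -> loop_params r f g c ->
  main_choice f g c e -> e != 0 /\ (size (zgcd f g) <= size e)%N.
Proof.
move=> lf lg Hc He; have [v Ev] := lead_zgcd_dvd f g.
have [_ pw] := main_choice_large lf lg Hc He Ev.
case: He => pp _ He; split; first exact: modgcd_neq0 He.
by have [] := modgcd_multiple pp pw (zgcd_divl f g) (zgcd_divr f g) He.
Qed.

(** The first case is the success of lucky primes: e then determines (w / lead h) h
    modulo p, and p is large enough to lift it. The second is the correctness of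
    every accepted candidate: d divides h and has at least its degree. *)
Lemma candidate_eq_zgcd (r : int) (f g : {poly int}) (c : params) (p : nat)
    (e : {poly 'F_p}) (t : 'F_p) :
  0 < lead_coef f -> 0 < lead_coef g -> loop_params r f g c ->
  main_choice f g c e -> lead_coef (t *: e) = (bw c)%:~R ->
  let d := zprimitive (reconstruct (t *: e)) in
  (size e = size (zgcd f g) \/ (divides d f /\ divides d g)) -> d = zgcd f g.
Proof.
move=> lf lg Hc He lE d; have [v Ev] := lead_zgcd_dvd f g.
have [B pw] := main_choice_large lf lg Hc He Ev.
have [e0 sle] := main_choice_size lf lg Hc He.
case: He => pp _ He; case: Hc => _ _ _ Ew _.
have f0 : f != 0 by rewrite -lead_coef_eq0 gt_eqF.
case=> [se|[[x Ex] [y Ey]]].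
  rewrite /d (modgcd_lift (v := v) pp pw (zgcd_divl f g) (zgcd_divr f g) He se).
    rewrite reconstruct_reduce // zprimitiveZ ?zprimitive_id //.
    by apply: contraNneq pw => v0; rewrite Ev v0 mul0r dvdz0.
  by rewrite lE Ew Ev.
have t0 : t != 0.
  apply: contraNneq pw => t0; rewrite -intr_Fp_eq0 // -Ew -lE t0 scale0r.
  by rewrite lead_coef0.
apply: zprimitive_dvd_eq; rewrite ?/d ?zprimitive_id ?zgcd_neq0 //.
  by rewrite dvdp_zgcd // [X in _ %| X]Ex [X in _ && (_ %| X)]Ey !dvdp_mull.
by rewrite [X in (_ <= X)%N]size_zprimitive size_reconstruct // size_scale.
Qed.

(** * Termination and correctness *)

(** The termination measure of the main loop, for R as in
    [unlucky_primes_divide]. *)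
Definition unused_bad_primes (R : int) (ps : seq nat) : nat :=
  count (fun p => p \notin ps) (primes `|R|%N).

Lemma unused_bad_primes_cons (R : int) (p : nat) (ps : seq nat) :
  R != 0 -> prime p -> (p%:Z %| R)%Z -> p \notin ps ->
  (unused_bad_primes R (p :: ps) < unused_bad_primes R ps)%N.
Proof.
move=> R0 pp pR pps; rewrite /unused_bad_primes.
have pin : p \in primes `|R|%N.
  by rewrite mem_primes pp absz_gt0 R0; move: pR; rewrite dvdzE.
elim: (primes _) pin => //= x s IH; rewrite !inE.
have sub : (count (fun z => z \notin p :: ps) s <= count (fun z => z \notin ps) s)%N.
  by apply: sub_count => z; rewrite inE negb_or => /andP[].
by case: eqVneq => [<- _|_ /IH]; rewrite ?pps ?eqxx //= ?add0n ?ltnS // => {sub}; lia.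
Qed.

(** The Bezout constant R is the same for all p, so only finitely many primes are
    unlucky. *)
Lemma unlucky_primes_divide (f g : {poly int}) : 0 < lead_coef f -> 0 < lead_coef g ->
  exists2 R : int, R != 0 &
    forall r c p (e : {poly 'F_p}), loop_params r f g c -> main_choice f g c e ->
      size e != size (zgcd f g) -> (p%:Z %| R)%Z.
Proof.
move=> lf lg; have f0 : f != 0 by rewrite -lead_coef_eq0 gt_eqF.
have [f1 [g1 [a [b [R [Ef Eg R0 E]]]]]] := zgcd_bezout g f0.
exists R => // r c p e Hc He; apply: contraR => pR.
have [v Ev] := lead_zgcd_dvd f g.
have [_ pw] := main_choice_large lf lg Hc He Ev.
case: He => pp _ He; apply/eqP.
by apply: (@modgcd_size_good p f1 g1 a b _ R) => //; rewrite -Ef -Eg.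
Qed.

(** The main loop is entered again only after an unlucky prime: either
    deg h < D <= deg e, or the division test failed, which it cannot do for a
    lucky prime. The hypothesis on D is maintained because D is replaced by the
    degree of an unlucky modular gcd. *)
Lemma loop_terminates (r : int) (f g : {poly int}) (c : params) (ps : seq nat) (D : nat) :
  0 < lead_coef f -> 0 < lead_coef g -> loop_params r f g c ->
  (deg (zgcd f g) < D)%N -> terminates (ChooseMain c ps D).
Proof.
move=> lf lg Hc; have [R R0 bad] := unlucky_primes_divide lf lg.
move: {2}(unused_bad_primes R ps).+1 (ltnSn (unused_bad_primes R ps)) => n.
elim: n ps D => [|n IH] ps D; first by rewrite ltn0.
rewrite ltnS => psn hD.
have [_ Ef Eg _ _] := Hc.
constructor=> _ [p [e [pp pps pM He ->]]].
rewrite Ef Eg in He; have Hm : main_choice f g c e by split.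
have [e0 hs] := main_choice_size lf lg Hc Hm.
have again D' : size e != size (zgcd f g) -> (deg (zgcd f g) < D')%N ->
    terminates (ChooseMain c (p :: ps) D').
  move=> se; apply: IH; apply: leq_trans _ psn.
  by apply: unused_bad_primes_cons => //; exact: (bad _ _ _ _ Hc Hm se).
constructor=> _ ->; case: leqP => De.
  by apply: again => //; apply: contraTneq De => se; rewrite -ltnNge /deg se.
constructor=> _ [t [lE ->]]; constructor=> _ [[_ [_ ->]]|[nd ->]].
  by constructor.
have se : size e != size (zgcd f g).
  apply: contra_notN nd => /eqP se.
  rewrite Ef Eg (candidate_eq_zgcd lf lg Hc Hm lE (or_introl se)).
  by split; [apply: zgcd_divl | apply: zgcd_divr].
apply: again => //.
have : (size (zgcd f g) < size e)%N by rewrite ltn_neqAle eq_sym se.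
have : (0 < size (zgcd f g))%N.
  by rewrite size_poly_gt0 zgcd_neq0 // -lead_coef_eq0 gt_eqF.
by rewrite /deg; case: (size (zgcd f g)) (size e) => [|m] [|k].
Qed.

Lemma loop_params_init (r : int) (f g : {poly int}) (q : nat) (e : {poly 'F_q}) :
  prime q -> ~~ (q%:Z %| gcdz (lead_coef f) (lead_coef g))%Z ->
  is_gcd e (reduce q f) (reduce q g) ->
  loop_params r f g (Params r f g (gcdz (lead_coef f) (lead_coef g))
    (2 ^+ deg e * (gcdz (lead_coef f) (lead_coef g))%:~R *
     Num.min (l2norm f / (lead_coef f)%:~R) (l2norm g / (lead_coef g)%:~R))).
Proof.
move=> pq qw He; split=> //=; exists (deg e) => //.
have [_ _ sle] := modgcd_multiple pq qw (zgcd_divl f g) (zgcd_divr f g) He.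
by rewrite /deg; case: (size _) sle => // n; case: (size e).
Qed.

Lemma deg_zgcd_lt (f g : {poly int}) : f != 0 -> g != 0 ->
  (deg (zgcd f g) < (minn (deg f) (deg g)).+1)%N.
Proof.
move=> f0 g0; rewrite ltnS leq_min /deg size_zprimitive.
by rewrite -!subn1 !leq_sub2r // dvdp_leq ?dvdp_gcdl ?dvdp_gcdr.
Qed.

(** At the division test the scalar t is remembered, since the state itself
    carries only the candidate built from it. *)
Definition invariant (f0 g0 : {poly int}) (st : state) : Prop :=
  let r := gcdz (zcontents f0) (zcontents g0) in
  let f := zprimitive f0 in let g := zprimitive g0 in
  match st with
  | Start f' g' => f' = f0 /\ g' = g0
  | Bounds r' f' g' => [/\ r' = r, f' = f & g' = g]
  | ChooseAux r' f' g' w D =>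
      [/\ r' = r, f' = f, g' = g & w = gcdz (lead_coef f) (lead_coef g)]
  | ChooseMain c ps D => loop_params r f g c
  | TestDegree c ps D p e => loop_params r f g c /\ main_choice f g c e
  | Lift c ps p e => loop_params r f g c /\ main_choice f g c e
  | TestDivision c ps p e d =>
      [/\ loop_params r f g c, main_choice f g c e &
          exists2 t : 'F_p, lead_coef (t *: e) = (bw c)%:~R &
            d = zprimitive (reconstruct (t *: e))]
  | Output h => h = r *: zgcd f g
  end.

Lemma invariant_step (f0 g0 : {poly int}) (st st' : state) : f0 != 0 -> g0 != 0 ->
  invariant f0 g0 st -> step st st' -> invariant f0 g0 st'.
Proof.
move=> f00 g00.
have lf := lead_zprimitive_gt0 f00; have lg := lead_zprimitive_gt0 g00.
case: st => //.
- by move=> _ _ [-> ->] /= ->.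
- by move=> _ _ _ [-> -> ->] /= ->.
- move=> _ _ _ _ D [-> -> -> ->] /= [q [e [pq qw He ->]]].
  exact: loop_params_init.
- move=> c ps D Hc /= [p [e [pp _ pM He ->]]]; split=> //.
  by case: Hc => _ Ef Eg _ _; rewrite Ef Eg in He.
- by move=> c ps D p e [Hc Hm] /= ->; case: leqP.
- by move=> c ps p e [Hc Hm] /= [t [lE ->]]; split=> //; exists t.
- move=> c ps p e d [Hc Hm [t lE ->]] /= [[df [dg ->]]|[_ ->]] //.
  case: (Hc) => Er Ef Eg _ _; rewrite Ef Eg in df dg.
  by rewrite /= Er (candidate_eq_zgcd lf lg Hc Hm lE (or_intror (conj df dg))).
Qed.

(** The procedure never gets stuck: large primes exist and exceed both 2 M and all
    the earlier ones, modular gcds exist and are nonzero, and the division test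
    is decidable because the candidate is primitive. *)
Lemma invariant_progress (f0 g0 : {poly int}) (st : state) : f0 != 0 -> g0 != 0 ->
  invariant f0 g0 st -> halted st ->
  st = Output (gcdz (zcontents f0) (zcontents g0)
               *: zgcd (zprimitive f0) (zprimitive g0)).
Proof.
move=> f00 g00 Hi Hh.
have lf := lead_zprimitive_gt0 f00; have lg := lead_zprimitive_gt0 g00.
suff : (exists st', step st st') \/ (exists h, st = Output h).
  case=> [[st' /Hh]//|[h E]]; by move: Hi; rewrite E /= => ->.
case: st Hi {Hh} => /=.
- by left; eexists.
- by left; eexists.
- move=> r f g w D [_ Ef Eg Ew]; left.
  have [q qw pq] := prime_above `|w|%N.
  eexists; exists q, (gcdp (reduce q f) (reduce q g)); split=> //.
    have w0 : w != 0 by rewrite Ew gcdz_eq0 gt_eqF.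
    rewrite dvdzE; apply/negP => /dvdn_leq; rewrite absz_gt0 w0 => /(_ isT) /=; lia.
  exact: is_gcd_gcdp.
- move=> c ps D _; left.
  have [p pb pp] := prime_above (maxn (Num.bound `|2 * bM c|) (\max_(x <- ps) x)).
  move: pb; rewrite gtn_max => /andP[pM pps].
  eexists; exists p, (gcdp (reduce p (bf c)) (reduce p (bg c))); split=> //.
  + apply: contraL pps => pin; rewrite -leqNgt.
    exact: (leq_bigmax_seq (F := id)).
  + apply: le_lt_trans (ler_norm _) _.
    by apply: lt_trans (archi_boundP (normr_ge0 _)) _; rewrite ltr_nat.
  exact: is_gcd_gcdp.
- by left; eexists.
- move=> c ps p e [Hc Hm]; left.
  have [e0 _] := main_choice_size lf lg Hc Hm.
  eexists; exists ((bw c)%:~R / lead_coef e); split=> //.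
  by rewrite lead_coefZ divfK // lead_coef_eq0.
- move=> c ps p e d [_ _ [t _ ->]]; left.
  set u := reconstruct _.
  case: (boolP ((u %| bf c) && (u %| bg c))) => [/andP[uf ug]|nu].
    eexists; left; split; first exact/zprimitive_divides.
    by split; first exact/zprimitive_divides.
  eexists; right; split; last by [].
  case=> /zprimitive_divides uf /zprimitive_divides ug.
  by rewrite uf ug in nu.
- by right; eexists.
Qed.

Theorem mainTheorem3 (f g : {poly int}) (hf : f != 0) (hg : g != 0) :
  terminates (Start f g) /\
  (forall s : state, reachable (Start f g) s -> halted s ->
     exists h : {poly int}, s = Output h /\ is_gcd h f g).
Proof.
have lf := lead_zprimitive_gt0 hf; have lg := lead_zprimitive_gt0 hg.
split.
  constructor=> _ ->; constructor=> _ ->; constructor=> _ [q [e [pq qw He ->]]].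
  apply: (loop_terminates _ lf lg (loop_params_init _ pq qw He)).
  by apply: deg_zgcd_lt; rewrite zprimitive_eq0.
move=> st Hst Hh; exists (gcdz (zcontents f) (zcontents g)
                         *: zgcd (zprimitive f) (zprimitive g)); split.
  apply: invariant_progress => //.
  have : invariant f g (Start f g) by [].
  elim: Hst {Hh} => {st} [s s' h Hi|//|s s1 s2 _ IH1 _ IH2 Hi].
    exact: invariant_step h.
  by apply: IH2; apply: IH1.
exact: is_gcd_zgcd.
Qed.
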